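(* Let $n\ge1$. On the manifold $GL(2n,\mathbb R)$ with matrix coordinates $(x_{ij})_{1\le i,j\le 2n}$ consider the Pfaffian form $$\tilde\omega=\sum_{j=1}^{2n}\sum_{i=1}^{n}\bigl(x_{j,2i-1}\,dx_{j,2i}-x_{j,2i}\,dx_{j,2i-1}\bigr),$$ and let $\omega=\iota^*\tilde\omega$, where $\iota:SL(2n,\mathbb R)\to GL(2n,\mathbb R)$ is the natural inclusion. Then $\omega$ is a contact form on $SL(2n,\mathbb R)$ which is invariant by $SO(2n,\mathbb R)$, i.e. $L_A^*\omega=\omega$ for every $A\in SO(2n,\mathbb R)$, where $L_A:SL(2n,\mathbb R)\to SL(2n,\mathbb R)$, $L_A(M)=AM$.
   Context: A Pfaffian form is a differential $1$-form. A contact form on a $(2p+1)$-dimensional manifold is a Pfaffian form $\omega$ with $\omega\wedge(d\omega)^p\neq0$ at every point (here $2p+1=4n^2-1=\dim SL(2n,\mathbb R)$). $SO(2n,\mathbb R)$ is the compact subgroup of $SL(2n,\mathbb R)$ of orthogonal matrices of determinant $1$. *)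

(* Defs.v *)
(* MathComp-Analysis; the real line is an arbitrary R : realType. *)
From HB Require Import structures.
From mathcomp Require Import all_boot all_order all_algebra all_fingroup.
From mathcomp Require Import all_classical all_reals all_analysis.

Import Order.TTheory GRing.Theory Num.Theory.
Import numFieldNormedType.Exports.

Local Open Scope classical_set_scope.
Local Open Scope ring_scope.

(* C^k and C^oo maps on an open subset U of a finite-dimensional space V.  In
   finite dimension, f is C^(k+1) on U iff it is differentiable on U and each
   of its directional derivatives is C^k on U. *)
Fixpoint Ck_on {R : realType} {V W : normedModType R} (k : nat) (U : set V)
    (f : V -> W) : Prop :=
  match k with
  | 0 => forall x, U x -> {for x, continuous f}
  | k'.+1 => (forall x, U x -> differentiable f x) /\
             (forall v, Ck_on k' U ('D_v f))
  end.

Definition smooth_on {R : realType} {V W : normedModType R} (U : set V)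
    (f : V -> W) : Prop := forall k, Ck_on k U f.

(* A differential k-form assigns to a point x a function of k vectors.  It is a
   total function of the ambient space, to be read only at the points and the
   tangent vectors of the open subset or submanifold on which the form lives;
   that it is alternating, multilinear and smooth there is [form_on]. *)
Definition dform {R : realType} (V : normedModType R) (k : nat) : Type :=
  V -> ('I_k -> V) -> R.

Definition alternating_multilinear {R : realType} {V : normedModType R} {k : nat}
    (a : ('I_k -> V) -> R) : Prop :=
  (forall (v : 'I_k -> V) (i : 'I_k) (c : R) (x y : V),
     a (fun j => if j == i then c *: x + y else v j) =
     c * a (fun j => if j == i then x else v j) +
     a (fun j => if j == i then y else v j)) /\
  (forall (v : 'I_k -> V) (i j : 'I_k), i != j -> v i = v j -> a v = 0).

Definition form_on {R : realType} {V : normedModType R} {k : nat} (U : set V)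
    (a : dform V k) : Prop :=
  (forall x, U x -> alternating_multilinear (a x)) /\
  (forall v, smooth_on U (fun x => a x v)).

(* With the factor 1/(k! l!), dx /\ dy is the determinant, in agreement with
   the normalization of [extd] below. *)
Definition wedge {R : realType} {V : normedModType R} {k l : nat}
    (a : dform V k) (b : dform V l) : dform V (k + l) :=
  fun x v => (k`! * l`!)%:R^-1 *
    \sum_(s : 'S_(k + l)) (-1) ^+ s *
      (a x (fun i => v (s (lshift l i))) * b x (fun j => v (s (rshift k j)))).

Fixpoint wedge_pow {R : realType} {V : normedModType R} {k : nat}
    (a : dform V k) (p : nat) : dform V (p * k) :=
  match p with
  | 0 => fun _ _ => 1
  | p'.+1 => wedge a (wedge_pow a p')
  end.

(* Exterior derivative of a form on an open subset of a vector space, i.e.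
   Cartan's formula applied to constant vector fields. *)
Definition extd {R : realType} {V : normedModType R} {k : nat}
    (a : dform V k) : dform V k.+1 :=
  fun x v => \sum_(i < k.+1)
    (-1) ^+ i * 'D_(v i) (fun y => a y (fun j => v (lift i j))) x.

Definition pullback {R : realType} {V W : normedModType R} {k : nat}
    (f : V -> W) (a : dform W k) : dform V k :=
  fun x v => a (f x) (fun i => 'd f x (v i)).

(* f : U -> S is a smooth local parametrization (the inverse of a chart) of the
   m-dimensional submanifold S of E: an injective immersion of an open subset U
   of R^m which is a homeomorphism onto a relatively open subset of S. *)
Definition local_param {R : realType} {E : normedModType R} (m : nat)
    (S : set E) (U : set 'rV[R]_m) (f : 'rV[R]_m -> E) : Prop :=
  [/\ open U,
      smooth_on U f,
      (forall u, U u -> injective ('d f u)),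
      (exists2 O : set E, open O & f @` U = S `&` O) &
      (exists2 g : E -> 'rV[R]_m,
         {in U, cancel f g} & {within f @` U, continuous g})].

Definition submanifold {R : realType} {E : normedModType R} (m : nat)
    (S : set E) : Prop :=
  forall x, S x -> exists U f, local_param m S U f /\ (f @` U) x.

Definition tangent {R : realType} {E : normedModType R} (m : nat)
    (S : set E) (x v : E) : Prop :=
  exists U f u w, [/\ local_param m S U f, U u, f u = x & 'd f u w = v].

Definition eq_form {R : realType} {E : normedModType R} (m : nat) {k : nat}
    (S : set E) (a b : dform E k) : Prop :=
  forall x (v : 'I_k -> E), S x -> (forall i, tangent m S x (v i)) ->
    a x v = b x v.

(* The k-form a on the m-dimensional manifold S is smooth, alternating and
   multilinear; as usual this is expressed in local coordinates. *)
Definition form_on_submanifold {R : realType} {E : normedModType R} (m : nat)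
    {k : nat} (S : set E) (a : dform E k) : Prop :=
  forall U f, local_param m S U f -> form_on U (pullback f a).

(* Contact form on the (2p+1)-dimensional manifold S.  The form a /\ (da)^p of
   the manifold is by definition the one whose expression in the coordinates
   given by f is that of f^*a, and it must not vanish at any point. *)
Definition contact_form {R : realType} {E : normedModType R} (p : nat)
    (S : set E) (a : dform E 1) : Prop :=
  [/\ submanifold (2 * p + 1) S,
      form_on_submanifold (2 * p + 1) S a &
      forall U f, local_param (2 * p + 1) S U f -> forall u, U u ->
        exists v, wedge (pullback f a) (wedge_pow (extd (pullback f a)) p) u v
                  != 0].

(* f restricts to a map S -> S under which the form a on S is invariant. *)
Definition invariant_form {R : realType} {E : normedModType R} (m : nat)
    {k : nat} (S : set E) (f : E -> E) (a : dform E k) : Prop :=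
  (forall x, S x -> S (f x)) /\ eq_form m S (pullback f a) a.

Definition SLset (R : realType) (N : nat) : set 'M[R]_N :=
  [set M | \det M = 1].

Definition SOset (R : realType) (N : nat) : set 'M[R]_N :=
  [set A | A *m A^T = 1%:M /\ \det A = 1].

(* Since GL(N,R) is open in 'M[R]_N, its tangent spaces are all of 'M[R]_N and
   the inclusion SL(N,R) -> GL(N,R) is the restriction of this map. *)
Definition incl (R : realType) (N : nat) : 'M[R]_N -> 'M[R]_N := fun M => M.

Definition left_mul (R : realType) (N : nat) (A : 'M[R]_N) : 'M[R]_N -> 'M[R]_N :=
  fun M => A *m M.

(* The 1-form dx_ij, as the exterior derivative of the 0-form x_ij. *)
Definition dx (R : realType) (N : nat) (i j : 'I_N) : dform 'M[R]_N 1 :=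
  @extd R _ 0 (fun (M : 'M[R]_N) (_ : 'I_0 -> 'M[R]_N) => M i j).

Lemma col_fst_proof (n : nat) (i : 'I_n) : (2 * i < 2 * n)%N.
Proof. by rewrite ltn_pmul2l. Qed.

Lemma col_snd_proof (n : nat) (i : 'I_n) : ((2 * i).+1 < 2 * n)%N.
Proof. by rewrite !mul2n ltn_Sdouble. Qed.

(* Counting columns from 0, the columns 2i-1 and 2i (1 <= i <= n) are 2i and
   2i+1 (0 <= i < n). *)
Definition col_fst (n : nat) (i : 'I_n) : 'I_(2 * n) :=
  Ordinal (col_fst_proof n i).
Definition col_snd (n : nat) (i : 'I_n) : 'I_(2 * n) :=
  Ordinal (col_snd_proof n i).

Definition omega_GL (R : realType) (n : nat) : dform 'M[R]_(2 * n) 1 :=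
  fun M v => \sum_(j < 2 * n) \sum_(i < n)
    (M j (col_fst n i) * dx R _ j (col_snd n i) M v -
     M j (col_snd n i) * dx R _ j (col_fst n i) M v).

Definition omega_SL (R : realType) (n : nat) : dform 'M[R]_(2 * n) 1 :=
  pullback (incl R (2 * n)) (omega_GL R n).

(* Main.v *)
(* With Omega the standard symplectic form on the 2n x 2n matrices (the sum over
   the rows of the standard symplectic forms of R^(2n)), omega_M(X) = Omega(M, X),
   so d omega = 2 Omega and omega is, up to a factor, the contraction of d omega
   with the radial field M.  Hence omega is contact on every hypersurface
   transverse to that field: for v_1, ..., v_(2p+1) tangent at M,
   (omega /\ (d omega)^p)(v) is a nonzero multiple of Omega^(p+1)(M, v_1, ...,
   v_(2p+1)), that is, of the determinant of (M, v_1, ..., v_(2p+1)).  By Euler's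
   identity d det_M(M) = 2n det M, so M is not tangent to SL(2n, R) at M.  For the
   invariance, Omega(X, Y) depends on X and Y through X^T Y only. *)
Require Import Defs.
From HB Require Import structures.
From mathcomp Require Import all_boot all_order all_algebra all_fingroup.
From mathcomp Require Import all_classical all_reals all_analysis.
From mathcomp Require Import ring zify.

Import Order.TTheory GRing.Theory Num.Theory.
Import numFieldNormedType.Exports.

Set Implicit Arguments.
Unset Strict Implicit.
Unset Printing Implicit Defensive.

Local Open Scope classical_set_scope.
Local Open Scope ring_scope.

(** * The wedge product as an alternating sum *)

(** The embedding of ['S_l] into ['S_(k + l)] that fixes the first [k] points. Building it by
    iterated [lift_perm] makes the sign computable by induction. *)
Fixpoint lift_perms (k l : nat) (t : 'S_l) : 'S_(k + l) :=
  match k with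
  | 0 => t
  | k'.+1 => lift_perm ord0 ord0 (lift_perms k' t)
  end.

Lemma lift_perms_rshift k l (t : 'S_l) j :
  lift_perms k t (rshift k j) = rshift k (t j).
Proof.
elim: k => [|k IH] /=.
  by have E i : rshift 0 i = i by [exact: val_inj]; rewrite !E.
have E i : rshift k.+1 i = lift ord0 (rshift k i) :> 'I_(k.+1 + l).
  exact: val_inj.
by rewrite !E lift_perm_lift IH.
Qed.

Lemma lift_perms_lshift k l (t : 'S_l) i :
  lift_perms k t (lshift l i) = lshift l i.
Proof.
elim: k i => [[]//|k IH] /= i.
case: (unliftP ord0 i) => [j|] ->; last first.
  have -> : lshift l (ord0 : 'I_k.+1) = ord0 :> 'I_(k.+1 + l) by exact: val_inj.
  exact: lift_perm_id.
have -> : lshift l (lift ord0 j) = lift ord0 (lshift l j) :> 'I_(k.+1 + l).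
  exact: val_inj.
by rewrite lift_perm_lift IH.
Qed.

Lemma odd_lift_perms k l (t : 'S_l) : odd_perm (lift_perms k t) = odd_perm t.
Proof. by elim: k => //= k IH; rewrite odd_lift_perm IH. Qed.

(** By injectivity a permutation fixing 0 sends nonzero indices to nonzero indices, so it restricts
    to a permutation of them. *)
Lemma lift_perm0_onto n (t : 'S_n.+1) :
  t ord0 = ord0 -> exists s, t = lift_perm ord0 ord0 s.
Proof.
move=> t0.
have tl (k : 'I_n) : exists k' : 'I_n, t (lift ord0 k) = lift ord0 k'.
  case: (unliftP ord0 (t (lift ord0 k))) => [k' ->|]; first by exists k'.
  by rewrite -[in RHS]t0 => /perm_inj /eqP; rewrite eq_sym (negPf (neq_lift _ _)).
have [f fE] := choice tl.
have inj : injective f.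
  by move=> a b ab; apply/(@lift_inj _ ord0)/(@perm_inj _ t); rewrite !fE ab.
exists (perm inj); apply/permP => k.
case: (unliftP ord0 k) => [k'|] ->; last by rewrite lift_perm_id.
by rewrite lift_perm_lift permE fE.
Qed.

Lemma sum_perm_fix0 (A : nmodType) n (F : 'S_n.+1 -> A) :
  \sum_(t : 'S_n.+1 | t ord0 == ord0) F t = \sum_s F (lift_perm ord0 ord0 s).
Proof.
have inj : {in predT &, injective (@lift_perm n ord0 ord0)}.
  move=> s t _ _ st; apply/permP => k; apply: (@lift_inj _ ord0).
  have /= := congr1 (fun u : 'S_n.+1 => u (lift ord0 k)) st.
  by rewrite !lift_perm_lift.
rewrite -(big_imset F inj); apply: eq_bigl => t.
apply/eqP/imsetP => [/lift_perm0_onto [s ->]|[s _ ->]]; first by exists s.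
exact: lift_perm_id.
Qed.

Section WedgeFormula.
Variables (R : realType) (V : normedModType R).

(* Each lift of a t in S_l can be absorbed into s by reindexing, so the l! terms
   of the second factor cancel the 1/l! of the wedge product. *)
Lemma wedge_antisymmetrization k l (a : dform V k) (b : dform V l)
    (g : ('I_l -> V) -> R) x
    (hb : forall w, b x w = \sum_(t : 'S_l) (-1) ^+ t * g (w \o t)) v :
  wedge a b x v = k`!%:R^-1 * \sum_(s : 'S_(k + l)) (-1) ^+ s *
    (a x (fun i => v (s (lshift l i))) * g (fun j => v (s (rshift k j)))).
Proof.
rewrite /wedge; set S := (X in _ = _ * X).
under eq_bigr => s _ do rewrite hb !big_distrr /=.
rewrite exchange_big /= (eq_bigr (fun=> S)) => [|t _]; last first.
  rewrite /S [RHS](reindex_inj (mulgI (lift_perms k t))) /=.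
  apply: eq_bigr => s _; rewrite odd_permM odd_lift_perms signr_addb.
  have -> : (fun i => v ((lift_perms k t * s)%g (lshift l i))) =
            (fun i => v (s (lshift l i))).
    by apply/funext => i; rewrite permM lift_perms_lshift.
  have -> : (fun j => v ((lift_perms k t * s)%g (rshift k j))) =
            (fun j => v (s (rshift k j))) \o t.
    by apply/funext => j /=; rewrite permM lift_perms_rshift.
  by rewrite -mulrA [X in _ * X = _]mulrCA [LHS]mulrCA.
have -> : \sum_(t : 'S_l) S = S *+ l`!.
  by rewrite sumr_const -card_Sn; congr (_ *+ _); apply: eq_card.
rewrite -[X in X%:R]/(k`! * l`!)%N natrM invfM -(mulr_natl S) -mulrA.
by congr (_ * _); rewrite mulKf // pnatr_eq0 -lt0n fact_gt0.
Qed.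

End WedgeFormula.

(** * Indices grouped in consecutive pairs *)

Lemma pair_idx_proof q (i : 'I_q) (b : bool) : (b + i * 2 < q * 2)%N.
Proof.
rewrite (@leq_trans (i.+1 * 2)%N) ?leq_mul2r ?ltn_ord ?orbT //.
by rewrite mulSn ltn_add2r; case: b.
Qed.

(** Block [i] consists of the positions [2i] and [2i+1], selected by [b]. The bound is written
    [q * 2] because that is the degree of [wedge_pow] of a 2-form. *)
Definition pair_idx q (i : 'I_q) (b : bool) : 'I_(q * 2) :=
  Ordinal (pair_idx_proof i b).

Lemma half_idx_proof q (k : 'I_(q * 2)) : (k./2 < q)%N.
Proof. by rewrite -divn2 ltn_divLR. Qed.

Definition half_idx q (k : 'I_(q * 2)) : 'I_q := Ordinal (half_idx_proof k).

Lemma half_idxK q (k : 'I_(q * 2)) : pair_idx (half_idx k) (odd k) = k.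
Proof. by apply: val_inj; rewrite /= [(k./2 * 2)%N]muln2 odd_double_half. Qed.

Lemma half_pair_idx q (i : 'I_q) b : half_idx (pair_idx i b) = i.
Proof. by apply: val_inj; rewrite /= muln2 half_bit_double. Qed.

Lemma odd_pair_idx q (i : 'I_q) b : odd (pair_idx i b) = b.
Proof. by rewrite /= oddD muln2 odd_double addbF oddb. Qed.

Lemma pair_idx_inj q (i j : 'I_q) b c :
  pair_idx i b = pair_idx j c -> i = j /\ b = c.
Proof.
move=> E; split; first by rewrite -(half_pair_idx i b) E half_pair_idx.
by rewrite -(odd_pair_idx i b) E odd_pair_idx.
Qed.

Lemma prod_pair_idx (R : comNzRingType) q (F : 'I_(q * 2) -> R) :
  \prod_k F k = \prod_(i < q) (F (pair_idx i false) * F (pair_idx i true)).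
Proof.
rewrite (partition_big (@half_idx q) predT) //=; apply: eq_bigr => i _.
rewrite (bigD1 (pair_idx i false)) ?half_pair_idx //=; congr (_ * _).
apply: big_pred1 => k /=; apply/andP/eqP => [[/eqP <-]|->].
  by case: (odd k) (half_idxK k) => E; rewrite E ?eqxx.
by rewrite half_pair_idx; split => //; apply/eqP => /pair_idx_inj[].
Qed.

(** Acts on block numbers and keeps the place inside the block. Arbitrary [f] are allowed because
    [pfaffian_sum_det] expands a product of sums over all functions, injective or not. *)
Definition pair_map q (f : 'I_q -> 'I_q) (k : 'I_(q * 2)) : 'I_(q * 2) :=
  pair_idx (f (half_idx k)) (odd k).

Lemma pair_map_idx q (f : 'I_q -> 'I_q) i b :
  pair_map f (pair_idx i b) = pair_idx (f i) b.
Proof. by rewrite /pair_map half_pair_idx odd_pair_idx. Qed.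

Lemma pair_perm_inj q (s : 'S_q) : injective (pair_map s).
Proof.
move=> k l /pair_idx_inj[/perm_inj h o].
by rewrite -[k]half_idxK h o half_idxK.
Qed.

Definition pair_perm q (s : 'S_q) : 'S_(q * 2) := perm (@pair_perm_inj q s).

Lemma pair_permE q (s : 'S_q) i b :
  pair_perm s (pair_idx i b) = pair_idx (s i) b.
Proof. by rewrite permE pair_map_idx. Qed.

Lemma perm_pairP q (s t : 'S_(q * 2)) :
  (forall i b, s (pair_idx i b) = t (pair_idx i b)) -> s = t.
Proof. by move=> st; apply/permP => k; rewrite -[k]half_idxK st. Qed.

Lemma pair_permM q (s t : 'S_q) :
  pair_perm (s * t)%g = (pair_perm s * pair_perm t)%g.
Proof. by apply: perm_pairP => i b; rewrite permM !pair_permE permM. Qed.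

Lemma pair_perm_tperm q (i j : 'I_q) : pair_perm (tperm i j) =
  (tperm (pair_idx i false) (pair_idx j false) *
   tperm (pair_idx i true) (pair_idx j true))%g.
Proof.
have T b k c : tperm (pair_idx i b) (pair_idx j b) (pair_idx k c) =
    pair_idx (if b == c then tperm i j k else k) c.
  case: eqP => [<-|bc]; last first.
    by rewrite tpermD //; apply/eqP => /pair_idx_inj[].
  case: (tpermP i j k) => [->|->|ki kj]; rewrite ?tpermL ?tpermR //.
  by rewrite tpermD //; apply/eqP => /pair_idx_inj[] /esym.
by apply: perm_pairP => k b; rewrite pair_permE permM !T; case: b.
Qed.

(* Exchanging two blocks is a product of two transpositions. *)
Lemma odd_pair_perm q (s : 'S_q) : odd_perm (pair_perm s) = false.
Proof.
have [ts -> _] := prod_tpermP s.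
elim: ts => [|[i j] ts IH] /=.
  rewrite big_nil (_ : @pair_perm q 1%g = 1%g) ?odd_perm1 //.
  by apply: perm_pairP => i b; rewrite pair_permE !perm1.
rewrite big_cons pair_permM odd_permM IH addbF pair_perm_tperm odd_permM !odd_tperm.
have E b : (pair_idx i b != pair_idx j b) = (i != j).
  by congr (~~ _); apply/eqP/eqP => [/pair_idx_inj[]|->].
by rewrite !E addbb.
Qed.

(** Composition with a transposition permutes the summation range and flips every sign. *)
Lemma alternating_sum_tperm (R : pzRingType) n (a b : 'I_n) (F : 'S_n -> R) :
  a != b ->
  \sum_(s : 'S_n) (-1) ^+ s * F s =
  - \sum_(s : 'S_n) (-1) ^+ s * F (tperm a b * s)%g.
Proof.
move=> ab; rewrite (reindex_inj (mulgI (tperm a b))) -sumrN /=.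
by apply: eq_bigr => s _; rewrite odd_permM odd_tperm ab -mulNr signr_addb mulN1r.
Qed.

(** Peels off the first block. The two index types agree by conversion of [p.+1 * 2] to [2 + p * 2],
    so no cast is inserted. *)
Lemma pair_idx_lift p (i : 'I_p) b :
  pair_idx (lift ord0 i) b = rshift 2 (pair_idx i b) :> 'I_(2 + p * 2).
Proof. by apply: val_inj; rewrite /= /bump add1n mulSn addnCA. Qed.

(* 2^q q! times the Pfaffian of the antisymmetric part of U. *)
Definition pfaffian_sum (R : comNzRingType) q (U : 'I_(q * 2) -> 'I_(q * 2) -> R) : R :=
  \sum_(s : 'S_(q * 2)) (-1) ^+ s *
    \prod_(i < q) U (s (pair_idx i false)) (s (pair_idx i true)).

(** * Wedge powers of a 2-form as Pfaffian sums *)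

Section WedgePower.
Variables (R : realType) (V : normedModType R).

(** Induction on [p]. In the alternating sum the two terms of [b] contribute equally, because
    swapping the first two arguments costs a sign that cancels the minus. The resulting 2 cancels
    the [2!] in the wedge product, so no factorial remains. *)
Lemma wedge_pow_pfaffian (b : dform V 2) (c : R) (U : V -> V -> R) x p
    (hb : forall w, b x w = c * (U (w ord0) (w ord_max) - U (w ord_max) (w ord0)))
    (v : 'I_(p * 2) -> V) :
  wedge_pow b p x v = c ^+ p * pfaffian_sum (fun k l => U (v k) (v l)).
Proof.
elim: p v => [|p IH] v /=.
  by rewrite /pfaffian_sum (big_pred1 1%g) => [|s];
    rewrite ?odd_perm1 ?big_ord0 ?mulr1 //; apply/esym/eqP/permP => -[].
pose g (w : 'I_(p * 2) -> V) :=
  c ^+ p * \prod_(i < p) U (w (pair_idx i false)) (w (pair_idx i true)).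
rewrite (@wedge_antisymmetrization _ _ _ _ _ _ g) => [|w]; last first.
  rewrite IH /pfaffian_sum big_distrr /=; apply: eq_bigr => s _.
  by rewrite /g mulrCA.
pose F (s : 'S_(2 + p * 2)) := U (v (s ord0)) (v (s (lshift (p * 2) ord_max))) *
  g (fun j => v (s (rshift 2 j))).
have ne : ord0 != lshift (p * 2) ord_max :> 'I_(2 + p * 2) by [].
pose tau := tperm (ord0 : 'I_(2 + p * 2)) (lshift (p * 2) ord_max).
(* [tau] exchanges the two arguments of [b] and fixes the others, so the second term of [b] at [s]
   is [F] at [tau * s]. *)
transitivity ((2`!)%:R^-1 * (c * (\sum_(s : 'S_(2 + p * 2)) (-1) ^+ s * F s -
    \sum_(s : 'S_(2 + p * 2)) (-1) ^+ s * F (tau * s)%g))).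
  congr (_ * _); rewrite -sumrB big_distrr /=; apply: eq_bigr => s _.
  rewrite hb /F !permM tpermL tpermR.
  have -> : (fun j => v ((tau * s)%g (rshift 2 j))) = (fun j => v (s (rshift 2 j))).
    apply/funext => j; rewrite permM tpermD //; exact/eqP.
  have -> : lshift (p * 2) (ord0 : 'I_2) = ord0 by exact: val_inj.
  by rewrite -mulrBr -mulrBl -[c * _ * _]mulrA [LHS]mulrCA.
rewrite -(@alternating_sum_tperm _ _ _ _ F ne).
have -> : c ^+ p.+1 * pfaffian_sum (fun k l : 'I_(p.+1 * 2) => U (v k) (v l)) =
    c * \sum_(s : 'S_(2 + p * 2)) (-1) ^+ s * F s.
  rewrite /pfaffian_sum !big_distrr /=; apply: eq_bigr => s _.
  rewrite big_ord_recl /F /g exprS -!mulrA; congr (_ * _).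
  have -> : pair_idx (ord0 : 'I_p.+1) false = ord0 :> 'I_(2 + p * 2).
    exact: val_inj.
  have -> : pair_idx (ord0 : 'I_p.+1) true = lshift (p * 2) ord_max :> 'I_(2 + p * 2).
    exact: val_inj.
  rewrite [LHS]mulrCA; congr (_ * _); rewrite [LHS]mulrCA; congr (_ * (_ * _)).
  by apply: eq_bigr => i _; rewrite !pair_idx_lift.
by rewrite mulrDr -mulr2n -[_ *+ 2]mulr_natl mulKf // pnatr_eq0.
Qed.

(** The sum is shaped for comparison with [pfaffian_sum_expand]: [a x] stands where the expansion
    has the antisymmetrized pairing with a distinguished vector. *)
Lemma wedge_wedge_pow_pfaffian (a : dform V 1) (b : dform V 2) (c : R)
    (U : V -> V -> R) x p
    (hb : forall w, b x w = c * (U (w ord0) (w ord_max) - U (w ord_max) (w ord0)))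
    (v : 'I_(1 + p * 2) -> V) :
  wedge a (wedge_pow b p) x v = c ^+ p * \sum_(s : 'S_(1 + p * 2)) (-1) ^+ s *
    (a x (fun=> v (s ord0)) * \prod_(i < p)
      U (v (s (rshift 1 (pair_idx i false)))) (v (s (rshift 1 (pair_idx i true))))).
Proof.
pose g (w : 'I_(p * 2) -> V) :=
  c ^+ p * \prod_(i < p) U (w (pair_idx i false)) (w (pair_idx i true)).
rewrite (@wedge_antisymmetrization _ _ _ _ _ _ g) => [|w]; last first.
  rewrite (wedge_pow_pfaffian hb) /pfaffian_sum big_distrr /=.
  by apply: eq_bigr => s _; rewrite /g mulrCA.
rewrite invr1 mul1r big_distrr /=; apply: eq_bigr => s _.
rewrite [RHS]mulrCA /g; congr (_ * _); rewrite mulrCA; congr (_ * (a x _ * _)).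
by apply/funext => i; rewrite ord1; congr (v (s _)); apply: val_inj.
Qed.

End WedgePower.

(** * Expansion of Pfaffian sums and their value as a determinant *)

Section PfaffianSum.
Variables (R : comNzRingType).

(** Permuting whole blocks is an even permutation and only reorders the factors of a commutative
    product. *)
Lemma pfaffian_sum_pair_perm q (U : 'I_(q * 2) -> 'I_(q * 2) -> R) (t : 'S_q)
    (s : 'S_(q * 2)) :
  (-1) ^+ (pair_perm t * s)%g * \prod_(i < q) U
    ((pair_perm t * s)%g (pair_idx i false)) ((pair_perm t * s)%g (pair_idx i true)) =
  (-1) ^+ s * \prod_(i < q) U (s (pair_idx i false)) (s (pair_idx i true)).
Proof.
rewrite odd_permM odd_pair_perm addFb [in RHS](reindex_inj (@perm_inj _ t)) /=.
by congr (_ * _); apply: eq_bigr => i _; rewrite !permM !pair_permE.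
Qed.

Lemma half_pair_permV q (t : 'S_q) k :
  half_idx ((pair_perm t)^-1%g k) = (t^-1)%g (half_idx k).
Proof.
apply: (@perm_inj _ t); rewrite permKV -[in RHS](permKV (pair_perm t) k).
by rewrite [in RHS]permE half_pair_idx.
Qed.

Lemma half_idx_eq q (i : 'I_q) k :
  (half_idx k == i) = (k == pair_idx i false) || (k == pair_idx i true).
Proof.
apply/eqP/orP => [<-|[]/eqP ->]; rewrite ?half_pair_idx //.
by case: (odd k) (half_idxK k) => E; [right|left]; rewrite E.
Qed.

(* o and l are ord0 and lift ord0 up to the conversion of p.+1 * 2 to 2 + p * 2. *)
Lemma pfaffian_sum_expand p (U : 'I_(p.+1 * 2) -> 'I_(p.+1 * 2) -> R)
    (o : 'I_(p.+1 * 2)) (l : 'I_(1 + p * 2) -> 'I_(p.+1 * 2)) :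
  o = ord0 :> 'I_(2 + p * 2) ->
  (forall k, l k = lift ord0 k :> 'I_(2 + p * 2)) ->
  pfaffian_sum U = p.+1%:R * \sum_(s : 'S_(1 + p * 2)) (-1) ^+ s *
    ((U o (l (s ord0)) - U (l (s ord0)) o) * \prod_(i < p)
      U (l (s (rshift 1 (pair_idx i false)))) (l (s (rshift 1 (pair_idx i true))))).
Proof.
move=> oE lE; rewrite /pfaffian_sum.
pose T (t : 'S_(p.+1 * 2)) : R := (-1) ^+ t *
  \prod_(i < p.+1) U (t (pair_idx i false)) (t (pair_idx i true)).
rewrite -/(T _).
(* The permutations are sorted by the block in which the value [o] occurs. Exchanging that block
   with the first one shows that all [p.+1] classes have the same sum, whence the factor [p.+1]. *)
rewrite (partition_big (fun t : 'S_(p.+1 * 2) => half_idx ((t^-1)%g o)) predT) //=.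
transitivity (\sum_(i < p.+1)
  \sum_(t : 'S_(p.+1 * 2) | half_idx ((t^-1)%g o) == ord0) T t).
  apply: eq_bigr => i _.
  rewrite (reindex_inj (mulgI (pair_perm (tperm ord0 i)))) /=.
  apply: eq_big => [t|t _]; last exact: pfaffian_sum_pair_perm.
  rewrite invMg permM half_pair_permV tpermV.
  by rewrite -[X in _ == X](tpermL ord0 i) (inj_eq (@perm_inj _ _)).
rewrite sumr_const card_ord -[LHS]mulr_natl; congr (_ * _).
pose a0 : 'I_(p.+1 * 2) := pair_idx ord0 false.
pose b0 : 'I_(p.+1 * 2) := pair_idx ord0 true.
have ab : a0 != b0 by apply/eqP => /pair_idx_inj[].
have tV (t : 'S_(p.+1 * 2)) k : ((t^-1)%g o == k) = (t k == o).
  by apply/eqP/eqP => [<-|<-]; rewrite ?permK ?permKV.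
(* Inside the first block [o] is in the first or in the second place. Swapping the places carries
   the second case to the first with a sign, and this gives the difference of the two values of
   [U]. *)
rewrite (bigID (fun t : 'S_(p.+1 * 2) => t a0 == o)) /=.
rewrite (eq_bigl (fun t : 'S_(p.+1 * 2) => t a0 == o)) => [|t]; last first.
  by rewrite half_idx_eq !tV -/a0; case: (t a0 == o); rewrite ?andbF.
rewrite [X in _ + X](eq_bigl (fun t : 'S_(p.+1 * 2) => t b0 == o)) => [|t]; last first.
  rewrite half_idx_eq !tV -/a0 -/b0; case: eqP => [<-|_] /=.
  + by apply/esym/eqP => /perm_inj/eqP; rewrite eq_sym (negPf ab).
  + by rewrite andbT.
rewrite [X in _ + X](reindex_inj (mulgI (tperm a0 b0))) /=.
rewrite [X in _ + X](eq_bigl (fun t : 'S_(p.+1 * 2) => t a0 == o)) => [|t]; last first.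
  by rewrite permM tpermR.
rewrite -big_split /=.
pose G (t : 'S_(1 + p * 2).+1) := (-1) ^+ t *
  ((U (t ord0) (t (lift ord0 ord0)) - U (t (lift ord0 ord0)) (t ord0)) *
   \prod_(i < p) U (t (lift ord0 (rshift 1 (pair_idx i false))))
                   (t (lift ord0 (rshift 1 (pair_idx i true))))).
transitivity (\sum_(t : 'S_(1 + p * 2).+1 | t ord0 == ord0) G t).
  apply: eq_big => [t|t _].
    rewrite oE (_ : a0 = ord0 :> 'I_(2 + p * 2)) //; exact: val_inj.
  rewrite /T odd_permM odd_tperm ab signr_addb !big_ord_recl.
  have a0E : a0 = ord0 :> 'I_(2 + p * 2) by exact: val_inj.
  have b0E : b0 = lift ord0 ord0 :> 'I_(2 + p * 2) by exact: val_inj.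
  rewrite -/a0 -/b0 !permM tpermL tpermR /G.
  have E i b : pair_idx (lift ord0 i) b = lift ord0 (rshift 1 (pair_idx i b))
      :> 'I_(2 + p * 2) by rewrite pair_idx_lift; exact: val_inj.
  rewrite [X in _ * (_ * X) + _](eq_bigr (fun i : 'I_p =>
    U (t (lift ord0 (rshift 1 (pair_idx i false))))
      (t (lift ord0 (rshift 1 (pair_idx i true)))))) => [|i _]; last by rewrite !E.
  rewrite [X in _ + _ * (_ * X)](eq_bigr (fun i : 'I_p =>
    U (t (lift ord0 (rshift 1 (pair_idx i false))))
      (t (lift ord0 (rshift 1 (pair_idx i true)))))) => [|i _]; last first.
    by rewrite !permM !tpermD ?E // ?a0E ?b0E.
  by rewrite a0E b0E mulN1r mulNr -mulrBr -mulrBl.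
rewrite sum_perm_fix0; apply: eq_bigr => s _.
rewrite /G lift_perm_id !lift_perm_lift oE !lE odd_lift_perm addFb.
do 2!congr (_ * _); apply: eq_bigr => i _.
by rewrite !lE -!(lift_perm_lift ord0 ord0 s).
Qed.

(** Expanding the product of sums gives one term for each function [f] from blocks to blocks: the
    determinant of the columns of [W] selected by [pair_map f]. It vanishes for a non-injective [f],
    where a column is repeated. Each of the [q!] permutations gives [\det W], since permuting blocks
    is even. *)
Lemma pfaffian_sum_det q (W : 'M[R]_(q * 2)) :
  pfaffian_sum (fun k l =>
    \sum_(r < q) W k (pair_idx r false) * W l (pair_idx r true)) =
  q`!%:R * \det W.
Proof.
rewrite /pfaffian_sum.
transitivity (\sum_(f : {ffun 'I_q -> 'I_q}) \sum_(s : 'S_(q * 2))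
    (-1) ^+ s * \prod_k W (s k) (pair_map f k)).
  rewrite exchange_big; apply: eq_bigr => s _; rewrite -big_distrr /=.
  congr (_ * _); rewrite bigA_distr_bigA /=; apply: eq_bigr => f _.
  by rewrite prod_pair_idx; apply: eq_bigr => i _; rewrite !pair_map_idx.
rewrite (bigID (fun f : {ffun 'I_q -> 'I_q} => injectiveb f)) /=.
rewrite [X in _ + X]big1 ?addr0 => [|f Uf]; last first.
  transitivity (\det (\matrix_(k, l) W l (pair_map f k))).
    by apply: eq_bigr => s _; congr (_ * _); apply: eq_bigr => k _; rewrite mxE.
  case/injectivePn: Uf => i [j ij fij].
  apply: (@determinant_alternate _ _ _ (pair_idx i false) (pair_idx j false)).
    by apply/eqP => /pair_idx_inj[] /eqP; rewrite (negPf ij).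
  by move=> k; rewrite !mxE !pair_map_idx fij.
(* Injective functions are the underlying functions of permutations; the identity is only the
   default value of [insubd]. *)
rewrite (reindex (@pval _)) /=; last first.
  pose in_Sn := insubd (1%g : 'S_q).
  by exists in_Sn => /= f Uf; first apply: val_inj; apply: insubdK.
transitivity (\sum_(t : 'S_q) \det W).
  apply: eq_big => [t|t _]; first exact: (valP t).
  rewrite -det_tr (reindex_inj (mulgI (pair_perm t))) /=; apply: eq_bigr => s _.
  rewrite odd_permM odd_pair_perm addFb; congr (_ * _).
  rewrite [RHS](reindex_inj (@perm_inj _ (pair_perm t))) /=.
  by apply: eq_bigr => k _; rewrite mxE permM; congr (W _ _); rewrite [RHS]permE pvalE.
have -> : \sum_(t : 'S_q) \det W = \det W *+ q`!.
  by rewrite sumr_const -card_Sn; congr (_ *+ _); apply: eq_card.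
by rewrite mulr_natl.
Qed.

End PfaffianSum.

(** * Maps of class C^k *)

Section DifferentiabilityClasses.
Context {R : realType}.

(** The first-order expansion at [x] involves only values near [x], so [g] inherits that of [f],
    with the same linear part. *)
Lemma near_eq_differentiable (V W : normedModType R) (f g : V -> W) x :
  (\near x, f x = g x) -> differentiable f x -> differentiable g x.
Proof.
move=> fg df; have fgx : f x = g x := nbhs_singleton fg.
have fg0 : \forall h \near (0 : V), f (h + x) = g (h + x).
  by rewrite (near_shift x) sub0r; near=> h; rewrite /= subrK; near: h.
have E : g \o shift x = cst (g x) + 'd f x +o_ 0 id.
  have /eqaddoP := diff_locally df => dfo.
  apply/eqaddoP => e e0; near=> h.
  have <- : (f \o shift x - (cst (f x) + 'd f x)) h =
            (g \o shift x - (cst (g x) + 'd f x)) h.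
    rewrite /= !fctE /= fgx; congr (_ - _).
    by near: h.
  by near: h; apply: dfo.
have dgf : 'd g x = 'd f x :> (V -> W).
  by apply: diff_unique E; exact: diff_continuous.
by apply/diff_locallyP; rewrite dgf; split => //; exact: diff_continuous.
Unshelve. all: by end_near. Qed.

(** As [U] is open, equality on [U] is equality near each of its points, hence it passes to
    directional derivatives and induction applies. *)
Lemma Ck_on_ext (V W : normedModType R) k (U : set V) (f g : V -> W) :
  open U -> {in U, f =1 g} -> Ck_on k U f -> Ck_on k U g.
Proof.
move=> oU; have nU x : U x -> \forall y \near x, U y.
  by move=> Ux; apply: open_nbhs_nbhs.
elim: k f g => [|k IH] f g fg /=.
  move=> cf x Ux; have fgn : \near x, f x = g x.
    by near=> y; apply: fg; rewrite inE; near: y; exact: nU.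
  have := cf x Ux; rewrite /prop_for /continuous_at (nbhs_singleton fgn).
  exact: cvg_trans (near_eq_cvg fgn).
move=> [df Cf]; have fgn x : U x -> \near x, f x = g x.
  by move=> Ux; near=> y; apply: fg; rewrite inE; near: y; exact: nU.
split=> [x Ux|v]; first exact: near_eq_differentiable (fgn x Ux) (df x Ux).
apply: IH (Cf v) => x; rewrite inE => Ux.
exact: near_eq_derive (fgn x Ux).
Unshelve. all: by end_near. Qed.

(** The induction step of the closure properties below: the derivative may be replaced by a formula
    valid on [U] only. *)
Lemma Ck_onS (V W : normedModType R) k (U : set V) (f : V -> W) (df : V -> V -> W) :
  open U -> (forall x, U x -> differentiable f x) ->
  (forall v x, U x -> 'D_v f x = df v x) -> (forall v, Ck_on k U (df v)) ->
  Ck_on k.+1 U f.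
Proof.
move=> oU df_ dE Cdf; split=> // v; apply: Ck_on_ext (Cdf v) => // x.
by rewrite inE => Ux; rewrite dE.
Qed.

Lemma Ck_onW (V W : normedModType R) k (U : set V) (f : V -> W) :
  Ck_on k.+1 U f -> Ck_on k U f.
Proof.
elim: k f => [|k IH] f /=; last by case=> df Cf; split=> // v; exact: IH (Cf v).
by case=> df _ x Ux; exact: differentiable_continuous (df x Ux).
Qed.

Lemma Ck_on_cst (V W : normedModType R) k (U : set V) (c : W) :
  open U -> Ck_on k U (cst c : V -> W).
Proof.
move=> oU; elim: k c => [|k IH] c; first by move=> x _; exact: cst_continuous.
apply: (@Ck_onS _ _ _ _ _ (fun _ => cst 0)) => // v x _.
exact: derive_cst.
Qed.

Lemma Ck_onD (V W : normedModType R) k (U : set V) (f g : V -> W) :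
  open U -> Ck_on k U f -> Ck_on k U g -> Ck_on k U (fun x => f x + g x).
Proof.
move=> oU; elim: k f g => [|k IH] f g.
  by move=> cf cg x Ux; apply: continuousD; [exact: cf|exact: cg].
move=> [df Cf] [dg Cg].
apply: (@Ck_onS _ _ _ _ _ (fun v x => 'D_v f x + 'D_v g x)) => //.
- by move=> x Ux; apply: differentiableD; [exact: df|exact: dg].
- by move=> v x Ux; apply: deriveD; apply: diff_derivable; [exact: df|exact: dg].
- by move=> v; apply: IH; [exact: Cf|exact: Cg].
Qed.

Lemma Ck_on_sum (V W : normedModType R) k (U : set V) (I : Type) (r : seq I)
    (P : pred I) (f : I -> V -> W) :
  open U -> (forall i, P i -> Ck_on k U (f i)) ->
  Ck_on k U (fun x => \sum_(i <- r | P i) f i x).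
Proof.
move=> oU Cf; elim: r => [|i r IH].
  by apply: Ck_on_ext (Ck_on_cst k 0 oU) => // x _; rewrite big_nil.
case Pi: (P i); first apply: Ck_on_ext (Ck_onD oU (Cf i Pi) IH) => // x _.
  by rewrite big_cons Pi.
by apply: Ck_on_ext IH => // x _; rewrite big_cons Pi.
Qed.

Lemma derive_linear_comp (V W W' : normedModType R) (L : {linear W -> W'})
    (f : V -> W) x v : continuous L -> differentiable f x ->
  'D_v (L \o f) x = L ('D_v f x).
Proof.
move=> cL df; have dL := linear_differentiable (f x) cL.
rewrite deriveE; last exact: differentiable_comp.
by rewrite diff_comp // diff_lin //= deriveE.
Qed.

Lemma Ck_on_linear (V W W' : normedModType R) k (U : set V) (L : {linear W -> W'})
    (f : V -> W) : open U -> continuous L -> Ck_on k U f -> Ck_on k U (L \o f).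
Proof.
move=> oU cL; elim: k f => [|k IH] f.
  by move=> cf x Ux; apply: continuous_comp; [exact: cf|exact: cL].
move=> [df Cf]; apply: (@Ck_onS _ _ _ _ _ (fun v x => L ('D_v f x))) => //.
- move=> x Ux; apply: differentiable_comp (df x Ux) _.
  exact: linear_differentiable.
- by move=> v x Ux; apply: derive_linear_comp => //; exact: df.
- by move=> v; exact: IH (Cf v).
Qed.

Lemma Ck_onM (V : normedModType R) k (U : set V) (f g : V -> R) :
  open U -> Ck_on k U f -> Ck_on k U g -> Ck_on k U (fun x => f x * g x).
Proof.
move=> oU; elim: k f g => [|k IH] f g.
  by move=> cf cg x Ux; apply: continuousM; [exact: cf|exact: cg].
move=> Cf0 Cg0; have [df Cf] := Cf0; have [dg Cg] := Cg0.
apply: (@Ck_onS _ _ _ _ _ (fun v x => f x * 'D_v g x + g x * 'D_v f x)) => //.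
- by move=> x Ux; apply: differentiableM; [exact: df|exact: dg].
- by move=> v x Ux; apply: deriveM; apply: diff_derivable; [exact: df|exact: dg].
- move=> v; apply: Ck_onD => //; apply: IH;
    [exact: Ck_onW Cf0|exact: Cg|exact: Ck_onW Cg0|exact: Cf].
Qed.

Lemma Ck_on_prod (V : normedModType R) k (U : set V) (I : Type) (r : seq I)
    (f : I -> V -> R) :
  open U -> (forall i, Ck_on k U (f i)) -> Ck_on k U (fun x => \prod_(i <- r) f i x).
Proof.
move=> oU Cf; elim: r => [|i r IH].
  by apply: Ck_on_ext (@Ck_on_cst V _ k U (1 : R) oU) => // x _; rewrite big_nil.
by apply: Ck_on_ext (Ck_onM oU (Cf i) IH) => // x _; rewrite big_cons.
Qed.

(** The derivative of [1/f] involves [1/f] again, one class lower, which is what the induction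
    hypothesis provides. *)
Lemma Ck_onV (V : normedModType R) k (U : set V) (f : V -> R) :
  open U -> (forall x, U x -> f x != 0) -> Ck_on k U f ->
  Ck_on k U (fun x => (f x)^-1).
Proof.
move=> oU f0; elim: k => [|k IH].
  by move=> cf x Ux; apply: cvgV; [exact: f0|exact: cf].
move=> Cf0; have [df Cf] := Cf0; have CV := IH (Ck_onW Cf0).
apply: (@Ck_onS _ _ _ _ _
    (fun v x => -1 * ((f x)^-1 * (f x)^-1 * 'D_v f x))) => //.
- by move=> x Ux; apply: differentiableV; [exact: df|exact: f0].
- move=> v x Ux; rewrite deriveV //; [|exact: f0|exact: diff_derivable (df x Ux)].
  by rewrite mulN1r /GRing.scale /= mulNr expr2 invfM.
- move=> v; apply: (Ck_onM oU (@Ck_on_cst V _ k U (-1 : R) oU)).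
  by apply: Ck_onM (Cf v) => //; exact: Ck_onM.
Qed.

Lemma Ck_on_id (V : normedModType R) k (U : set V) :
  open U -> Ck_on k U (fun x : V => x).
Proof.
move=> oU; case: k => [|k]; first by move=> x _; exact: cvg_id.
apply: (@Ck_onS _ _ _ _ _ (fun v => cst v)) => // [v x _|v].
  exact: derive_id.
exact: Ck_on_cst.
Qed.

Lemma Ck_on_coord (V : normedModType R) m n k (U : set V) (f : V -> 'M[R]_(m, n)) i j :
  open U -> Ck_on k U f -> Ck_on k U (fun x => f x i j).
Proof.
move=> oU Cf.
have lin : linear (fun N : 'M[R]_(m, n) => N i j : R) by move=> a M N; rewrite !mxE.
pose L : {linear 'M[R]_(m, n) -> R} := HB.pack (fun N : 'M[R]_(m, n) => N i j : R)
  (GRing.isLinear.Build _ _ _ _ _ lin).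
by apply: (@Ck_on_linear _ _ _ k U L) => //; exact: coord_continuous.
Qed.

Lemma derive_coord (V : normedModType R) m n (f : V -> 'M[R]_(m, n)) x v i j :
  differentiable f x -> 'D_v (fun y => f y i j) x = ('D_v f x) i j.
Proof. by move=> df; rewrite derive_mx ?mxE //; exact: diff_derivable. Qed.

Lemma Ck_on_mx (V : normedModType R) m n k (U : set V) (f : V -> 'M[R]_(m, n)) :
  open U -> (forall i j, Ck_on k U (fun x => f x i j)) -> Ck_on k U f.
Proof.
move=> oU Cf.
have Cs i j : Ck_on k U (fun x => f x i j *: (delta_mx i j : 'M[R]_(m, n))).
  have lin : linear (fun c : R => c *: (delta_mx i j : 'M[R]_(m, n))).
    by move=> a b c; rewrite scalerDl scalerA.
  pose L : {linear R -> 'M[R]_(m, n)} := HB.pack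
    (fun c : R => c *: (delta_mx i j : 'M[R]_(m, n)))
    (GRing.isLinear.Build _ _ _ _ _ lin).
  by apply: (@Ck_on_linear _ _ _ k U L) => //; exact: scalel_continuous.
apply: Ck_on_ext (Ck_on_sum (index_enum _) oU (fun i (_ : true) =>
  Ck_on_sum (index_enum _) oU (fun j (_ : true) => Cs i j))) => // x _.
by rewrite -matrix_sum_delta.
Qed.

Lemma Ck_on_det (V : normedModType R) n k (U : set V) (A : V -> 'M[R]_n) :
  open U -> (forall i j, Ck_on k U (fun x => A x i j)) ->
  Ck_on k U (fun x => \det (A x)).
Proof.
move=> oU CA; apply: Ck_on_sum => // s _.
apply: (Ck_onM oU (@Ck_on_cst V _ k U ((-1) ^+ s : R) oU)).
exact: Ck_on_prod.
Qed.

(** * Symmetry of mixed second derivatives *)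

Lemma is_derive_line (V W : normedModType R) (f : V -> W) y v (s : R) :
  differentiable f (s *: v + y) ->
  is_derive s 1 (fun t => f (t *: v + y)) ('D_v f (s *: v + y)).
Proof.
move=> df.
have dl : is_diff s (fun t : R => t *: v + y) ( *:%R^~ v) .
  by apply: is_diff_eq; rewrite addr0.
have dc : is_diff s (f \o (fun t : R => t *: v + y))
    ('d f (s *: v + y) \o ( *:%R^~ v)).
  by apply: is_diff_comp; apply: differentiableP.
apply: DeriveDef; first exact: diff_derivable.
by rewrite (@deriveE _ _ _ (f \o _)) // diff_val /= scale1r deriveE.
Qed.

(** The mean value theorem is used twice: for [f (s *: v + (h *: w + u)) - f (s *: v + u)] as a
    function of [s], then for ['D_v f] along [w] at the intermediate [s]. *)
Lemma second_difference (V : normedModType R) (U : set V) (f : V -> R) (u v w : V) (h : R) :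
  0 < h -> Ck_on 2 U f ->
  (forall s t : R, 0 <= s <= h -> 0 <= t <= h -> U (s *: v + (t *: w + u))) ->
  exists s t : R, [/\ 0 <= s <= h, 0 <= t <= h &
    f (h *: v + (h *: w + u)) - f (h *: v + u) - f (h *: w + u) + f u =
    h ^+ 2 * 'D_w ('D_v f) (s *: v + (t *: w + u))].
Proof.
move=> h0 [df Cf] Uh; have [dDf _] := Cf v.
have h00 : 0 <= (0 : R) <= h by rewrite lexx ltW.
have hh : 0 <= h <= h by rewrite lexx ltW.
have U0 (s : R) : 0 <= s <= h -> U (s *: v + u).
  by move=> /Uh /(_ h00); rewrite scale0r add0r.
have dphi (s : R) : s \in `[0, h] -> is_derive s 1
   ((fun s => f (s *: v + (h *: w + u))) - (fun s => f (s *: v + u)))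
   ('D_v f (s *: v + (h *: w + u)) - 'D_v f (s *: v + u)).
  rewrite in_itv /= => sh.
  by apply: is_deriveB; apply: is_derive_line; apply: df; [apply: Uh|apply: U0].
have [s sh E] := @MVT_segment R _ _ 0 h (ltW h0)
  (fun s sh => dphi s (subset_itv_oo_cc sh))
  (derivable_within_continuous (fun s sh => @ex_derive _ _ _ _ _ _ _ (dphi s sh))).
have {}sh : 0 <= s <= h by move: sh; rewrite in_itv.
have dpsi (t : R) : t \in `[0, h] -> is_derive t 1
   (fun t => 'D_v f (t *: w + (s *: v + u))) ('D_w ('D_v f) (t *: w + (s *: v + u))).
  rewrite in_itv /= => th; apply: is_derive_line; apply: dDf.
  by rewrite addrCA; exact: Uh.
have [t th E'] := @MVT_segment R _ _ 0 h (ltW h0)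
  (fun s sh => dpsi s (subset_itv_oo_cc sh))
  (derivable_within_continuous (fun s sh => @ex_derive _ _ _ _ _ _ _ (dpsi s sh))).
exists s, t; split=> //.
move: E E'; rewrite /= !fctE !scale0r !add0r !subr0 => E E'.
rewrite [s *: v + (t *: w + u)]addrCA expr2 mulrAC -mulrA.
rewrite -E' [h *: w + (s *: v + u)]addrCA [h * _]mulrC -E.
by rewrite opprB [f u - _]addrC [RHS]addrA.
Qed.

Lemma near_parallelogram (V : normedModType R) (u v w : V) (P : set V) :
  (\near u, P u) -> exists2 h : R, 0 < h &
    forall s t : R, 0 <= s <= h -> 0 <= t <= h -> P (s *: v + (t *: w + u)).
Proof.
(* The size [r / c] works because points of the parallelogram are within [r / c * (|v| + |w|)] of
   [u]; the added 1 makes [c] positive and the bound strict. *)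
move=> /nbhs_ballP [r /= r0 rP]; pose c := `|v| + `|w| + 1.
have c0 : 0 < c by rewrite ltr_wpDl // addr_ge0.
have h0 : 0 < r / c by rewrite divr_gt0.
exists (r / c) => // s t /andP[s0 sh] /andP[t0 th]; apply: rP.
rewrite -ball_normE /ball_ /= addrA opprD addrCA subrr addr0 normrN.
apply: le_lt_trans (ler_normD _ _) _; rewrite !normrZ !ger0_norm //.
apply: (@le_lt_trans _ _ (r / c * (`|v| + `|w|))).
  by rewrite mulrDr lerD // ler_wpM2r.
by rewrite mulrAC ltr_pdivrMr // ltr_pM2l // ltrDl.
Qed.

Lemma close_values_eq (a b x y c : R) : 0 < c -> c * x = c * y ->
  `|a - x| < `|a - b| / 2 -> `|b - y| < `|a - b| / 2 -> False.
Proof.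
move=> c0 /mulfI; rewrite gt_eqF // => /(_ isT) ->; rewrite [`|b - y|]distrC.
move=> ay yb; have := le_lt_trans (ler_distD y a b) (ltrD ay yb).
by rewrite -splitr ltxx.
Qed.

(** Schwarz's theorem. If the two mixed derivatives differed at [u], by continuity each would stay
    within half the gap of its value at [u] on a small parallelogram. But the second difference is
    symmetric in [v] and [w], so it is [h ^+ 2] times a value of each, and these two values
    coincide. *)
Lemma derive_comm (V : normedModType R) (U : set V) (f : V -> R) u v w :
  open U -> Ck_on 2 U f -> U u -> 'D_w ('D_v f) u = 'D_v ('D_w f) u.
Proof.
move=> oU Cf Uu; apply/eqP/negPn/negP => ne.
pose A := 'D_w ('D_v f) u; pose B := 'D_v ('D_w f) u.
pose e := `|A - B| / 2.
have e0 : 0 < e by rewrite divr_gt0 // normr_gt0 subr_eq0.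
have cA : \near u, `|A - 'D_w ('D_v f) u| < e.
  by have [_ /(_ v) [_ /(_ w) /(_ u Uu) /cvgrPdist_lt]] := Cf; apply.
have cB : \near u, `|B - 'D_v ('D_w f) u| < e.
  by have [_ /(_ w) [_ /(_ v) /(_ u Uu) /cvgrPdist_lt]] := Cf; apply.
have nU : \near u, U u by apply: open_nbhs_nbhs.
have [h h0 hP] := near_parallelogram v w (filterI nU (filterI cA cB)).
have [s [t [sh th E]]] := second_difference h0 Cf (fun s t sh th => (hP s t sh th).1).
have Uh' s' t' : 0 <= s' <= h -> 0 <= t' <= h -> U (s' *: w + (t' *: v + u)).
  by move=> sh' th'; rewrite addrCA; have [] := hP t' s' th' sh'.
have [s' [t' [sh' th' E']]] := second_difference h0 Cf Uh'.
have [_ [dA _]] := hP s t sh th; have [_ [_ dB]] := hP t' s' th' sh'.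
move: E; rewrite [h *: v + (_ + _)]addrCA [X in X + f u]addrAC E'.
rewrite [t' *: v + _]addrCA in dB => /esym E.
exact: (close_values_eq (exprn_gt0 2 h0) E dA dB).
Qed.

End DifferentiabilityClasses.

(** * SL(N, R) as a submanifold *)

Lemma Ck_on_cofactor (R : realType) (V : normedModType R) n k (U : set V)
    (A : V -> 'M[R]_n) i j :
  open U -> (forall i j, Ck_on k U (fun x => A x i j)) ->
  Ck_on k U (fun x => cofactor (A x) i j).
Proof.
move=> oU CA; apply: (Ck_onM oU (@Ck_on_cst _ V _ k U ((-1) ^+ (i + j) : R) oU)).
apply: Ck_on_det => // a b; apply: Ck_on_ext (CA (lift i a) (lift j b)) => // x _.
by rewrite !mxE.
Qed.

Section GraphChart.
Variables (R : realType) (N m : nat) (i0 j0 : 'I_N) (h : 'I_m -> 'I_N * 'I_N).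
Hypothesis h_inj : injective h.
Hypothesis h_im : forall ij, ij != (i0, j0) -> exists k, h k = ij.
Hypothesis h_ne : forall k, h k != (i0, j0).

(** [h] enumerates the positions other than [(i0, j0)]; [u] fills these and [c] fills the remaining
    one. *)
Definition fill (c : R) (u : 'rV[R]_m) : 'M[R]_N :=
  \matrix_(i, j) if [pick k | h k == (i, j)] is Some k then u ord0 k else c.

Definition unfill (M : 'M[R]_N) : 'rV[R]_m := \row_k M (h k).1 (h k).2.

Lemma fill_h c u k : fill c u (h k).1 (h k).2 = u ord0 k.
Proof.
rewrite mxE; case: pickP => [l|/(_ k)]; last by rewrite -surjective_pairing eqxx.
by rewrite -surjective_pairing => /eqP/h_inj ->.
Qed.

Lemma fill_c c u : fill c u i0 j0 = c.
Proof. by rewrite mxE; case: pickP => // k; rewrite (negPf (h_ne k)). Qed.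

Lemma unfillK (M : 'M[R]_N) : fill (M i0 j0) (unfill M) = M.
Proof.
apply/matrixP => i j; have [[-> ->]|ne] := (i, j) =P (i0, j0).
  exact: fill_c.
have /eqP/h_im [k hk] := ne.
by rewrite -[i]/((i, j).1) -[j in LHS]/((i, j).2) -[j in RHS]/((i, j).2) -hk fill_h mxE.
Qed.

Lemma fillK c : cancel (fill c) unfill.
Proof. by move=> u; apply/rowP => k; rewrite mxE fill_h. Qed.

(** Cofactors along row [i0] delete that row, and with it the entry [c]. *)
Lemma cofactor_fill c u j : cofactor (fill c u) i0 j = cofactor (fill 0 u) i0 j.
Proof.
congr (_ * \det _); apply/matrixP => a b; rewrite !mxE.
case: pickP => // nk; have : (lift i0 a, lift j b) != (i0, j0).
  by apply/eqP => -[/eqP]; rewrite eq_sym (negPf (neq_lift _ _)).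
by case/h_im => k hk; have := nk k; rewrite hk eqxx.
Qed.

Lemma det_fill c u :
  \det (fill c u) = \det (fill 0 u) + c * cofactor (fill 0 u) i0 j0.
Proof.
rewrite !(expand_det_row _ i0) (bigD1 j0) //= [in RHS](bigD1 j0) //=.
rewrite !fill_c !cofactor_fill mul0r add0r addrC; congr (_ + _).
apply: eq_bigr => j jj0; rewrite cofactor_fill; congr (_ * _); rewrite !mxE.
case: pickP => // nk; have : (i0, j) != (i0, j0) by rewrite xpair_eqE eqxx.
by case/h_im => k hk; have := nk k; rewrite hk eqxx.
Qed.

(** By [det_fill] the determinant is affine in the entry at [(i0, j0)], with its cofactor as slope.
    Solving for determinant 1 presents SL locally as the graph of a rational function of the other
    entries. *)
Definition graph_chart (u : 'rV[R]_m) : 'M[R]_N :=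
  fill ((1 - \det (fill 0 u)) / cofactor (fill 0 u) i0 j0) u.

Definition graph_domain : set 'rV[R]_m :=
  [set u | cofactor (fill 0 u) i0 j0 != 0].

Lemma Ck_on_fill k U c i j : open U -> Ck_on k U (fun u => fill c u i j).
Proof.
move=> oU; case E : [pick k | h k == (i, j)] => [l|].
  apply: Ck_on_ext (Ck_on_coord ord0 l oU (Ck_on_id k oU)) => // u _.
  by rewrite mxE E.
apply: Ck_on_ext (@Ck_on_cst _ _ _ k U (c : R) oU) => // u _.
by rewrite mxE E.
Qed.

Lemma open_cofactor_neq0 (V : normedModType R) (A : V -> 'M[R]_N) :
  (forall i j, Ck_on 0 setT (fun x => A x i j)) ->
  open [set x | cofactor (A x) i0 j0 != 0].
Proof.
move=> CA; apply: (@open_comp _ _ (fun x => cofactor (A x) i0 j0) [set x | x != 0]).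
  by move=> x _; apply: (Ck_on_cofactor i0 j0 openT CA).
exact: open_neq.
Qed.

Lemma open_graph_domain : open graph_domain.
Proof. by apply: open_cofactor_neq0 => i j; exact: Ck_on_fill openT. Qed.

Lemma graph_chart_smooth : smooth_on graph_domain graph_chart.
Proof.
have oU := open_graph_domain; move=> k; apply: Ck_on_mx => // i j.
case E : [pick k | h k == (i, j)] => [l|].
  apply: Ck_on_ext (Ck_on_coord ord0 l oU (Ck_on_id k oU)) => // u _.
  by rewrite mxE E.
apply: (@Ck_on_ext _ _ _ _ _ (fun u => (1 + -1 * \det (fill 0 u)) *
    (cofactor (fill 0 u) i0 j0)^-1)) => // [u _|]; first by rewrite mxE E mulN1r.
apply: Ck_onM => //; last first.
  by apply: Ck_onV => //; apply: Ck_on_cofactor => // a b; exact: Ck_on_fill.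
apply: (Ck_onD oU (@Ck_on_cst _ _ _ k _ (1 : R) oU)).
apply: (Ck_onM oU (@Ck_on_cst _ _ _ k _ (-1 : R) oU)).
by apply: Ck_on_det => // a b; exact: Ck_on_fill.
Qed.

Lemma graph_chart_SL u : graph_domain u -> \det (graph_chart u) = 1.
Proof. by move=> c0; rewrite det_fill divfK // addrC subrK. Qed.

Lemma graph_chart_onto (M : 'M[R]_N) : \det M = 1 -> cofactor M i0 j0 != 0 ->
  graph_domain (unfill M) /\ graph_chart (unfill M) = M.
Proof.
move=> d1 c0; have cE : cofactor (fill 0 (unfill M)) i0 j0 = cofactor M i0 j0.
  by rewrite -(cofactor_fill (M i0 j0)) unfillK.
split; first by rewrite /graph_domain /= cE.
rewrite /graph_chart -[in RHS](unfillK M); congr fill.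
have := det_fill (M i0 j0) (unfill M); rewrite unfillK d1 cE => ->.
by rewrite addrAC subrr add0r mulfK.
Qed.

Lemma graph_chart_local_param :
  local_param m (SLset R N) graph_domain graph_chart.
Proof.
have oU := open_graph_domain; split => //.
- exact: graph_chart_smooth.
- move=> u Uu v w vw; apply/rowP => k.
  have dg : differentiable graph_chart u by have [dg _] := graph_chart_smooth 1; exact: dg.
  (* The entry of the chart at position [h k] is the coordinate [u_k] itself, so these entries of
     the differential recover [x]. *)
  have E x : 'd graph_chart u x (h k).1 (h k).2 = x ord0 k.
    rewrite -deriveE // -derive_coord //.
    rewrite (_ : (fun y => _) = (fun y : 'rV[R]_m => y ord0 k)); last first.
      by apply/funext => y; rewrite fill_h.
    rewrite (@derive_coord _ _ _ _ (fun y : 'rV[R]_m => y)) ?derive_id //.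
  by rewrite -!E vw.
- exists [set M | cofactor M i0 j0 != 0].
    by apply: open_cofactor_neq0 => i j; exact: (Ck_on_coord i j openT (Ck_on_id 0 openT)).
  apply/seteqP; split => [_ [u Uu <-]|M [d1 c0]].
    by split; [exact: graph_chart_SL Uu|rewrite /= cofactor_fill; exact: Uu].
  by have [? <-] := graph_chart_onto d1 c0; exists (unfill M).
- exists unfill; first by move=> u _; exact: fillK.
  apply: continuous_subspaceT => M.
  suff : Ck_on 0 setT unfill by apply.
  apply: Ck_on_mx; [exact: openT|move=> i k].
  apply: (Ck_on_ext openT _ (Ck_on_coord (h k).1 (h k).2 openT (Ck_on_id 0 openT))) => A _.
  by rewrite mxE.
Qed.

End GraphChart.

(** If all cofactors along the first row of [M] vanished, its determinant would be 0 instead of 1.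
    So [M] lies in some graph chart, whose parameters are the [N * N - 1] other entries. *)
Lemma SL_submanifold (R : realType) N m : (0 < N)%N -> m.+1 = (N * N)%N ->
  submanifold m (SLset R N).
Proof.
move=> N0 mN M d1; pose i0 : 'I_N := Ordinal N0.
have [j0 c0] : exists j0, cofactor M i0 j0 != 0.
  apply/existsP; apply: contraTT isT => /existsPn c0.
  have := d1; rewrite /SLset /= (expand_det_row _ i0) big1 => [/esym/eqP|j _].
    by rewrite oner_eq0.
  by have := c0 j; rewrite negbK => /eqP ->; rewrite mulr0.
have cm : m = #|[set~ (i0, j0)]%SET|.
  by rewrite cardsC1 card_prod !card_ord -mN.
pose h (k : 'I_m) := enum_val (cast_ord cm k).
have h_inj : injective h by move=> k l /enum_val_inj/cast_ord_inj.
have h_ne k : h k != (i0, j0) by have := enum_valP (cast_ord cm k); rewrite !inE.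
have h_im ij : ij != (i0, j0) -> exists k, h k = ij.
  move=> ne; have Aij : ij \in [set~ (i0, j0)]%SET by rewrite !inE.
  exists (cast_ord (esym cm) (enum_rank_in Aij ij)).
  by rewrite /h cast_ordKV enum_rankK_in.
exists (@graph_domain R N m i0 j0 h), (graph_chart i0 j0 h).
split; first exact: graph_chart_local_param.
by have [? <-] := graph_chart_onto h_inj h_im h_ne d1 c0; exists (unfill h M).
Qed.

(** * The form omega *)

Lemma extd1E (R : realType) (V : normedModType R) (a : dform V 1) x w :
  extd a x w = 'D_(w ord0) (fun y => a y (fun=> w ord_max)) x -
               'D_(w ord_max) (fun y => a y (fun=> w ord0)) x.
Proof.
have i1 : lift ord0 ord0 = ord_max :> 'I_2 by exact: val_inj.
have w0 : (fun j : 'I_1 => w (lift ord0 j)) = (fun=> w ord_max).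
  by apply/funext => j; rewrite ord1 i1.
have w1 : (fun j : 'I_1 => w (lift ord_max j)) = (fun=> w ord0).
  by apply/funext => j; rewrite ord1; congr w; exact: val_inj.
by rewrite /extd big_ord_recl big_ord1 i1 w0 w1 mul1r mulN1r.
Qed.

Section Omega.
Variables (R : realType) (n : nat).
Local Notation mat := 'M[R]_(2 * n).

(** Half of the symplectic form: [col_pairing X Y - col_pairing Y X] is Omega. *)
Definition col_pairing (X Y : mat) : R :=
  \sum_j \sum_(i < n) X j (col_fst n i) * Y j (col_snd n i).

(** Shows that the pairing depends on [X^T *m Y] only, which yields both bilinearity and orthogonal
    invariance. *)
Lemma col_pairing_tr X Y :
  col_pairing X Y = \sum_(i < n) (X^T *m Y) (col_fst n i) (col_snd n i).
Proof.
rewrite /col_pairing exchange_big; apply: eq_bigr => i _ /=.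
by rewrite mxE; apply: eq_bigr => j _; rewrite mxE.
Qed.

Lemma col_pairing_linearl Y : scalar (col_pairing ^~ Y).
Proof.
move=> a X Z; rewrite !col_pairing_tr /GRing.scale /= big_distrr -big_split /=.
by apply: eq_bigr => i _; rewrite linearP /= mulmxDl -scalemxAl !mxE.
Qed.

Lemma col_pairing_linearr X : scalar (col_pairing X).
Proof.
move=> a Y Z; rewrite !col_pairing_tr /GRing.scale /= big_distrr -big_split /=.
by apply: eq_bigr => i _; rewrite mulmxDr -scalemxAr !mxE.
Qed.

Lemma dxE i j M v : dx R (2 * n) i j M v = v ord0 i j.
Proof.
rewrite /dx /extd big_ord1 mul1r.
by rewrite (@derive_coord _ _ _ _ (fun y : mat => y)) // derive_id.
Qed.

Lemma omega_SLE M v : omega_SL R n M v =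
  col_pairing M (v ord0) - col_pairing (v ord0) M.
Proof.
rewrite /omega_SL /pullback /omega_GL /col_pairing -sumrB; apply: eq_bigr => j _.
rewrite -sumrB; apply: eq_bigr => i _; rewrite !dxE.
rewrite (_ : 'd (Defs.incl R (2 * n)) M = id :> (mat -> mat)); last exact: diff_val.
by congr (_ - _); rewrite mulrC.
Qed.

Lemma Ck_on_col_pairing (V : normedModType R) k (U : set V) (f g : V -> mat) :
  open U -> Ck_on k U f -> Ck_on k U g ->
  Ck_on k U (fun x => col_pairing (f x) (g x)).
Proof.
move=> oU Cf Cg; apply: Ck_on_sum => // j _; apply: Ck_on_sum => // i _.
by apply: Ck_onM => //; apply: Ck_on_coord.
Qed.

Lemma derive_col_pairing (V : normedModType R) (f g : V -> mat) x v :
  differentiable f x -> differentiable g x ->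
  is_derive x v (fun y => col_pairing (f y) (g y))
    (col_pairing ('D_v f x) (g x) + col_pairing (f x) ('D_v g x)).
Proof.
move=> df dg.
have dco (h : V -> mat) a b : differentiable h x ->
    is_derive x v (fun y => h y a b) ('D_v h x a b).
  move=> dh; apply: DeriveDef; last exact: derive_coord.
  by apply: (derivable_mxP h x v).1; exact: diff_derivable.
rewrite (_ : (fun y => _) = \sum_(j < 2 * n) \sum_(i < n)
    ((fun y => f y j (col_fst n i)) * (fun y => g y j (col_snd n i)))); last first.
  apply/funext => y; rewrite fct_sumE; apply: eq_bigr => j _.
  by rewrite fct_sumE.
apply: is_derive_eq.
  apply: is_derive_sum => j; apply: is_derive_sum => i.
  by apply: is_deriveM; apply: dco.
rewrite /col_pairing -big_split; apply: eq_bigr => j _ /=.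
rewrite -big_split; apply: eq_bigr => i _ /=.
by rewrite addrC /GRing.scale /=; congr (_ + _); rewrite mulrC.
Qed.

Lemma derive_comm_mx (V : normedModType R) (U : set V) (f : V -> mat) u v w :
  open U -> Ck_on 2 U f -> U u -> 'D_w ('D_v f) u = 'D_v ('D_w f) u.
Proof.
move=> oU Cf Uu; apply/matrixP => i j.
have [df Df] := Cf; have nU : \near u, U u by apply: open_nbhs_nbhs.
have E a b : ('D_b ('D_a f) u) i j = 'D_b ('D_a (fun y => f y i j)) u.
  rewrite -derive_coord; last by have [dDf _] := Df a; exact: dDf.
  apply: near_eq_derive; near=> y; apply/esym/derive_coord/df.
  by near: y.
transitivity ('D_w ('D_v (fun y => f y i j)) u); first exact: E.
transitivity ('D_v ('D_w (fun y => f y i j)) u); last exact/esym/E.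
exact: (derive_comm v w oU (Ck_on_coord i j oU Cf) Uu).
Unshelve. all: by end_near. Qed.

Variables (m : nat) (U : set 'rV[R]_m) (f : 'rV[R]_m -> mat).
Hypothesis oU : open U.
Hypothesis fs : smooth_on U f.

Let df u : U u -> differentiable f u.
Proof. by have [df _] := fs 1; exact: df. Qed.

Lemma pullback_omegaE u v : U u -> pullback f (omega_SL R n) u v =
  col_pairing (f u) ('D_(v ord0) f u) - col_pairing ('D_(v ord0) f u) (f u).
Proof. by move=> Uu; rewrite /pullback omega_SLE deriveE //; exact: df. Qed.

Lemma pullback_omega_form : form_on U (pullback f (omega_SL R n)).
Proof.
split=> [u Uu|v k].
  split=> [v i c x y|v i j]; last by rewrite !ord1 eqxx.
  rewrite /pullback !omega_SLE !ord1 eqxx !linearP.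
  by rewrite col_pairing_linearl col_pairing_linearr /GRing.scale /= mulrBr opprD addrACA.
have [_ /(_ (v ord0)) Cd] := fs k.+1.
apply: (@Ck_on_ext _ _ _ _ _ (fun u => col_pairing (f u) ('D_(v ord0) f u) +
    -1 * col_pairing ('D_(v ord0) f u) (f u))) => // [u|].
  by rewrite inE => Uu; rewrite pullback_omegaE // mulN1r.
apply: Ck_onD => //; first by apply: Ck_on_col_pairing => //; exact: fs.
apply: Ck_onM => //; first exact: Ck_on_cst.
by apply: Ck_on_col_pairing => //; exact: fs.
Qed.

(** The product rule produces second derivatives of [f] paired with [f], which cancel by symmetry,
    and first derivatives paired together, which occur twice. *)
Lemma extd_pullback_omega u w : U u -> extd (pullback f (omega_SL R n)) u w =
  2 * (col_pairing ('D_(w ord0) f u) ('D_(w ord_max) f u) -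
       col_pairing ('D_(w ord_max) f u) ('D_(w ord0) f u)).
Proof.
move=> Uu; have nU : \near u, U u by apply: open_nbhs_nbhs.
have dD b : differentiable ('D_b f) u.
  by have [_ /(_ b) [dDf _]] := fs 2; exact: dDf.
(* The second derivative is a parameter [c], so that [sym] lets both halves of the exterior
   derivative use the same mixed derivative. *)
have D a b c : 'D_a ('D_b f) u = c ->
    'D_a (fun y => pullback f (omega_SL R n) y (fun=> b)) u =
    col_pairing ('D_a f u) ('D_b f u) + col_pairing (f u) c -
    (col_pairing c (f u) + col_pairing ('D_b f u) ('D_a f u)).
  move=> <-.
  rewrite (_ : 'D_a _ u = 'D_a ((fun y => col_pairing (f y) ('D_b f y)) -
      (fun y => col_pairing ('D_b f y) (f y))) u); last first.
    by apply: near_eq_derive; near=> y; apply: pullback_omegaE; near: y.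
  have d1 := derive_col_pairing a (df Uu) (dD b).
  have d2 := derive_col_pairing a (dD b) (df Uu).
  by rewrite deriveB // !derive_val.
have sym := derive_comm_mx (w ord0) (w ord_max) oU (fs 2) Uu.
have E (a b x y : R) : a + x - (y + b) - (b + x - (y + a)) = 2 * (a - b) by ring.
rewrite extd1E.
have D2 : _ - _ = _ - _ := congr2 (fun a b => a - b) 
  (D (w ord0) (w ord_max) _ erefl) (D _ (w ord0) _ sym).
exact: etrans D2 (E _ _ _ _).
Unshelve. all: by end_near. Qed.

End Omega.

(** * Transversality of the radial field to SL *)

Lemma Ck_on_det_id (R : realType) N k (U : set 'M[R]_N) :
  open U -> Ck_on k U (fun M : 'M[R]_N => \det M).
Proof.
move=> oU; apply: (Ck_on_det oU) => i j.
exact: (Ck_on_coord i j oU (Ck_on_id k oU)).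
Qed.

Lemma differentiable_det (R : realType) N (M : 'M[R]_N) :
  differentiable (fun M : 'M[R]_N => \det M) M.
Proof. by have [dd _] := @Ck_on_det_id R N 1 setT openT; exact: dd. Qed.

(* Euler's identity for the homogeneous polynomial det. *)
Lemma derive_det_radial (R : realType) N (M : 'M[R]_N) :
  'D_M (fun M : 'M[R]_N => \det M) M = N%:R * \det M.
Proof.
have dM : differentiable (fun M : 'M[R]_N => \det M) (0 *: M + M).
  exact: differentiable_det.
have := is_derive_line dM; rewrite scale0r add0r => d1.
(* Along the line through [M] in direction [M] the determinant is [(t + 1) ^+ N * \det M], to be
   differentiated at [t = 0]. *)
have E : (fun t : R => \det (t *: M + M)) = (id + cst 1) ^+ N * cst (\det M).
  apply/funext => t; rewrite -[X in _ + X]scale1r -scalerDl detZ.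
  by rewrite exprfctE.
rewrite E in d1; rewrite -(@derive_val _ _ _ _ _ _ _ d1).
case: N M {dM d1 E} => [|N] M.
  rewrite expr0 mul0r.
  rewrite (_ : 1 * cst (\det M) = cst (\det M)) ?derive_cst //; exact: mul1r.
rewrite derive_val scaler0 add0r addr0 !fctE add0r expr1n mulr1.
by rewrite /GRing.scale /= mulr1 mulrC.
Qed.

Section Transversality.
Variables (R : realType) (N m : nat) (U : set 'rV[R]_m) (f : 'rV[R]_m -> 'M[R]_N).
Hypotheses (N0 : (0 < N)%N) (fP : local_param m (SLset R N) U f).

Lemma local_param_det u : U u -> \det (f u) = 1.
Proof.
have [_ _ _ [V _ fU] _] := fP => Uu.
have : (SLset R N `&` V) (f u) by rewrite -fU; exists u.
by case.
Qed.

(** The determinant is constantly 1 along [f], so its derivative in direction [w] is 0; by the chain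
    rule and Euler's identity it is also [c * N]. *)
Lemma local_param_transverse u w c : U u -> 'd f u w = c *: f u -> c = 0.
Proof.
move=> Uu dfw; have [oU fs _ _ _] := fP.
have df : differentiable f u by have [df _] := fs 1; exact: df.
have dd := differentiable_det (f u).
have : 'D_w ((fun M : 'M[R]_N => \det M) \o f) u = c * N%:R.
  rewrite deriveE; last exact: differentiable_comp.
  rewrite diff_comp //= dfw linearZ /= -deriveE // derive_det_radial.
  by rewrite local_param_det // mulr1.
have nU : \near u, U u by apply: open_nbhs_nbhs.
rewrite (_ : 'D_w _ u = 'D_w (cst (1 : R)) u); last first.
  by apply: near_eq_derive; near=> y; apply: local_param_det; near: y.
rewrite derive_cst => /esym/eqP; rewrite mulf_eq0 pnatr_eq0 eqn0Ngt N0 orbF.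
by move/eqP.
Unshelve. all: by end_near. Qed.

End Transversality.

(** * Nondegeneracy on a frame *)

Lemma col_cases n (a : 'I_(2 * n)) :
  exists i, a = col_fst n i \/ a = col_snd n i.
Proof.
have an : (a./2 < n)%N by rewrite -divn2 ltn_divLR // [(n * 2)%N]mulnC.
exists (Ordinal an); case E : (odd a); [right|left]; apply: val_inj => /=;
  by rewrite [(2 * _)%N in RHS]mul2n -[LHS]odd_double_half E.
Qed.

Section Coordinates.
Variables (R : realType) (n q : nat) (hq : q = (2 * n * n)%N).

Lemma pair_card : q = #|{: 'I_(2 * n) * 'I_n}|.
Proof. by rewrite card_prod !card_ord. Qed.

(** A numbering of the pairs (row, pair of columns), which are the symplectic coordinate planes. *)
Definition row_block (r : 'I_q) : 'I_(2 * n) * 'I_n :=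
  enum_val (cast_ord pair_card r).

Lemma row_block_bij : bijective row_block.
Proof.
exists (fun x => cast_ord (esym pair_card) (enum_rank x)) => x.
  by rewrite /row_block enum_valK cast_ordK.
by rewrite /row_block cast_ordKV enum_rankK.
Qed.

(* Coordinates making the column pairing the standard one
   sum_r x_(2r) y_(2r+1). *)
Definition pair_coord (X : 'M[R]_(2 * n)) (l : 'I_(q * 2)) : R :=
  let ji := row_block (half_idx l) in
  X ji.1 (if odd l then col_snd n ji.2 else col_fst n ji.2).

Lemma pair_coord_fst X r :
  pair_coord X (pair_idx r false) = X (row_block r).1 (col_fst n (row_block r).2).
Proof. by rewrite /pair_coord half_pair_idx odd_pair_idx. Qed.

Lemma pair_coord_snd X r :
  pair_coord X (pair_idx r true) = X (row_block r).1 (col_snd n (row_block r).2).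
Proof. by rewrite /pair_coord half_pair_idx odd_pair_idx. Qed.

Lemma col_pairing_coord X Y : col_pairing X Y =
  \sum_(r < q) pair_coord X (pair_idx r false) * pair_coord Y (pair_idx r true).
Proof.
rewrite /col_pairing pair_big /= (reindex row_block) /=; last first.
  exact/onW_bij/row_block_bij.
by apply: eq_bigr => r _; rewrite pair_coord_fst pair_coord_snd.
Qed.

Lemma pair_coord_linear l : scalar (pair_coord ^~ l).
Proof. by move=> a X Y; rewrite /pair_coord !mxE. Qed.

Lemma pair_coord_eq0 X : (forall l, pair_coord X l = 0) -> X = 0.
Proof.
have [g _ gK] := row_block_bij => X0; apply/matrixP => j a; rewrite mxE.
have [i [] ->] := col_cases a.
  by rewrite -(X0 (pair_idx (g (j, i)) false)) pair_coord_fst gK.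
by rewrite -(X0 (pair_idx (g (j, i)) true)) pair_coord_snd gK.
Qed.

(** In symplectic coordinates the Pfaffian sum is [q!] times the determinant of the coordinate
    matrix of the [w k], and a vector in the left kernel of that matrix is a linear relation among
    them. *)
Lemma pfaffian_sum_col_pairing_neq0 (w : 'I_(q * 2) -> 'M[R]_(2 * n)) :
  (forall x : 'rV[R]_(q * 2), \sum_k x ord0 k *: w k = 0 -> x = 0) ->
  pfaffian_sum (fun k l => col_pairing (w k) (w l)) != 0.
Proof.
move=> wfree; pose W : 'M[R]_(q * 2) := \matrix_(k, l) pair_coord (w k) l.
have -> : (fun k l => col_pairing (w k) (w l)) = (fun k l =>
    \sum_(r < q) W k (pair_idx r false) * W l (pair_idx r true)).
  apply/funext => k; apply/funext => l; rewrite col_pairing_coord.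
  by apply: eq_bigr => r _; rewrite !mxE.
rewrite pfaffian_sum_det; apply: mulf_neq0; first by rewrite pnatr_eq0 -lt0n fact_gt0.
apply/negP => /det0P [x /eqP x0 xW]; apply: x0; apply: wfree.
apply: pair_coord_eq0 => l; have /rowP/(_ l) := xW; rewrite !mxE => <-.
have lin := pair_coord_linear l.
pose L : {scalar 'M[R]_(2 * n)} := HB.pack (pair_coord ^~ l)
  (GRing.isLinear.Build _ _ _ _ _ lin).
rewrite -[LHS]/(L _) linear_sum; apply: eq_bigr => k _.
by rewrite linearZ /= mxE.
Qed.

End Coordinates.

(** The point [f u] and the coordinate tangent vectors are independent: transversality kills [x0],
    then injectivity of the differential kills the rest. The cast [km] reconciles the degree
    [1 + p * 2] of the wedge product with the dimension [2 * p + 1]. *)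
Lemma local_param_frame (R : realType) N m k (U : set 'rV[R]_m)
    (f : 'rV[R]_m -> 'M[R]_N) u (km : k = m) (x0 : R) (x : 'I_k -> R) :
  (0 < N)%N -> local_param m (SLset R N) U f -> U u ->
  x0 *: f u + \sum_(l < k) x l *: 'd f u (delta_mx ord0 (cast_ord km l)) = 0 ->
  x0 = 0 /\ forall l, x l = 0.
Proof.
move=> N0 fP Uu; pose y : 'rV[R]_m := \row_j x (cast_ord (esym km) j).
have -> : \sum_(l < k) x l *: 'd f u (delta_mx ord0 (cast_ord km l)) = 'd f u y.
  rewrite [y]row_sum_delta linear_sum (reindex (cast_ord (esym km))) /=; last first.
    by exists (cast_ord km) => l _; rewrite ?cast_ordK ?cast_ordKV.
  by apply: eq_bigr => l _; rewrite linearZ /= mxE cast_ordKV.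
move=> /eqP; rewrite addrC addr_eq0 -scaleNr => /eqP dy.
have /eqP := local_param_transverse N0 fP Uu dy; rewrite oppr_eq0 => /eqP x00.
split=> // l; have [_ _ inj _ _] := fP.
have y0 : y = 0 by apply: (inj u Uu); rewrite dy x00 oppr0 scale0r linear0.
by have /rowP/(_ (cast_ord km l)) := y0; rewrite !mxE cast_ordK.
Qed.

(** At the coordinate frame, the wedge product is [2 ^+ p] times an alternating sum; [p.+1] times
    that sum is the Pfaffian sum of the frame preceded by [f u], expanded along [f u]. These
    [2p + 2] vectors are independent, so the Pfaffian sum is nonzero. *)
Lemma omega_SL_nondegenerate (R : realType) n p (U : set 'rV[R]_(2 * p + 1))
    (f : 'rV[R]_(2 * p + 1) -> 'M[R]_(2 * n)) u :
  (0 < n)%N -> p.+1 = (2 * n * n)%N ->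
  local_param (2 * p + 1) (SLset R (2 * n)) U f -> U u ->
  exists v, wedge (pullback f (omega_SL R n))
    (wedge_pow (extd (pullback f (omega_SL R n))) p) u v != 0.
Proof.
move=> n0 hp fP Uu; have [oU fs _ _ _] := fP.
have df : differentiable f u by have [df _] := fs 1; exact: df.
have N0 : (0 < 2 * n)%N by rewrite muln_gt0.
have km : (1 + p * 2 = 2 * p + 1)%N by rewrite addnC mulnC.
pose v (l : 'I_(1 + p * 2)) : 'rV[R]_(2 * p + 1) := delta_mx ord0 (cast_ord km l).
exists v.
rewrite (@wedge_wedge_pow_pfaffian _ _ _ _ 2
  (fun a b => col_pairing ('D_a f u) ('D_b f u))); last first.
  by move=> w; exact: (extd_pullback_omega oU fs).
apply: mulf_neq0; first by rewrite expf_neq0 // pnatr_eq0.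
(* The family [w] is [f u] followed by the images of the coordinate vectors. *)
pose w (k : 'I_(p.+1 * 2)) : 'M[R]_(2 * n) :=
  if unlift (ord0 : 'I_(2 + p * 2)) k is Some l then 'D_(v l) f u else f u.
have w0 : w (ord0 : 'I_(2 + p * 2)) = f u by rewrite /w unlift_none.
have wl l : w (lift (ord0 : 'I_(2 + p * 2)) l) = 'D_(v l) f u by rewrite /w liftK.
have : pfaffian_sum (fun k l => col_pairing (w k) (w l)) != 0.
  apply: (pfaffian_sum_col_pairing_neq0 hp) => x; rewrite big_ord_recl.
  rewrite [w _]w0 => x_w.
  have [x0 xl] : x ord0 (ord0 : 'I_(2 + p * 2)) = 0 /\
      forall l, x ord0 (lift (ord0 : 'I_(2 + p * 2)) l) = 0.
    apply: (local_param_frame (km := km) N0 fP Uu); rewrite -[RHS]x_w.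
    by congr (_ + _); apply: eq_bigr => l _; rewrite wl deriveE.
  apply/rowP => k; rewrite mxE.
  by case: (unliftP (ord0 : 'I_(2 + p * 2)) k) => [l|] ->.
rewrite (pfaffian_sum_expand _ (o := (ord0 : 'I_(2 + p * 2)))
  (l := lift (ord0 : 'I_(2 + p * 2)))) //.
apply: contra_neq => S0; rewrite [X in _ * X](_ : _ = 0) ?mulr0 // -[RHS]S0.
apply: eq_bigr => s _; congr (_ * (_ * _)).
  by rewrite (pullback_omegaE fs _ Uu) w0 wl.
by apply: eq_bigr => i _; rewrite !wl.
Qed.

(** * Invariance under SO and conclusion *)

Lemma omega_SL_invariant (R : realType) n m (A : 'M[R]_(2 * n)) :
  SOset R (2 * n) A ->
  invariant_form m (SLset R (2 * n)) (left_mul R _ A) (omega_SL R n).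
Proof.
move=> [AAT dA]; split=> [M dM|M v _ _].
  by rewrite /SLset /= /left_mul det_mulmx dA mul1r.
have lin : linear (left_mul R _ A) by move=> a X Y; rewrite /left_mul linearP.
pose L : {linear 'M[R]_(2 * n) -> 'M[R]_(2 * n)} := HB.pack (left_mul R _ A)
  (GRing.isLinear.Build _ _ _ _ _ lin).
have cL : continuous L.
  move=> X; suff : Ck_on 0 setT L by apply.
  apply: Ck_on_mx; first exact: openT; move=> i j.
  apply: (Ck_on_ext openT _ (Ck_on_sum (index_enum _) openT (fun k (_ : true) =>
    Ck_onM openT (@Ck_on_cst _ _ _ 0 setT (A i k : R) openT)
      (Ck_on_coord k j openT (Ck_on_id 0 openT))))) => Y _.
  by rewrite /= /left_mul mxE.
have dL : 'd (left_mul R _ A) M = left_mul R _ A :> (_ -> _) := diff_lin M cL.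
(* For a square matrix [A *m A^T = 1] also gives [A^T *m A = 1], so left multiplication by [A]
   preserves [X^T *m Y]. *)
have ATA X Y : (A *m X)^T *m (A *m Y) = X^T *m Y.
  by rewrite trmx_mul mulmxA -(mulmxA X^T) (mulmx1C AAT) mulmx1.
by rewrite /pullback !omega_SLE dL !col_pairing_tr /left_mul !ATA.
Qed.

Theorem theorem34 (R : realType) (n p : nat) (hn : (1 <= n)%N)
    (hp : (2 * p + 1 = 4 * n ^ 2 - 1)%N) :
  contact_form p (SLset R (2 * n)) (omega_SL R n) /\
  (forall A : 'M[R]_(2 * n), SOset R (2 * n) A ->
     invariant_form (2 * p + 1) (SLset R (2 * n)) (left_mul R _ A) (omega_SL R n)).
Proof.
(* The dimension count, rewritten as the number of symplectic coordinate planes. *)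
have pn : p.+1 = (2 * n * n)%N by move: hp; rewrite expnS expn1; nia.
split=> [|A]; last exact: omega_SL_invariant.
split.
- by apply: SL_submanifold; [rewrite muln_gt0|nia].
- by move=> U f [oU fs _ _ _]; exact: pullback_omega_form.
- by move=> U f fP u Uu; exact: (omega_SL_nondegenerate hn pn fP Uu).
Qed.
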